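(* There exists an absolute constant $c>0$ such that the following holds. Let $l\geq 1$ be an integer, let $F$ be a graph with $l$ vertices, and let $G$ be a maximal triangle-free graph with chromatic number $\chi(G)\geq \mathrm{e}^{c\,l^4}$. Then $G$ contains an induced subdivision of $F$, i.e. some induced subgraph of $G$ is isomorphic to a subdivision of $F$.
   Context: All graphs are finite, simple and undirected. A graph is triangle-free if it contains no three pairwise adjacent vertices. A triangle-free graph $G$ is maximal triangle-free if adding any edge between two distinct non-adjacent vertices of $G$ creates a triangle; equivalently, $G$ is triangle-free and any two distinct non-adjacent vertices have a common neighbor (triangle-free with diameter at most two). A subdivision of a graph $F$ is a graph obtained from $F$ by replacing each edge $uv$ of $F$ by a path of length at least $1$ with endpoints $u$ and $v$, where the internal vertices of these paths are new vertices, and distinct paths share no internal vertices ($F$ itself is a subdivision of $F$). $\chi(G)$ denotes the chromatic number of $G$. *)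

(* Defs.v *)
From mathcomp Require Import all_boot.

Set Implicit Arguments.
Unset Strict Implicit.
Unset Printing Implicit Defensive.

Record sgraph := SGraph {
  vertex :> finType;
  adj : rel vertex;
  adj_sym : symmetric adj;
  adj_irrefl : irreflexive adj }.

Definition isomorphic (G H : sgraph) : Prop :=
  exists f : G -> H, bijective f /\ forall x y, adj (f x) (f y) = adj x y.

Section Constructions.
Variable G : sgraph.

Lemma induced_sym (S : {set G}) :
  symmetric (fun x y : {x : G | x \in S} => adj (val x) (val y)).
Proof. by move=> x y; apply: adj_sym. Qed.

Lemma induced_irrefl (S : {set G}) :
  irreflexive (fun x y : {x : G | x \in S} => adj (val x) (val y)).
Proof. by move=> x; apply: adj_irrefl. Qed.

Definition induced (S : {set G}) : sgraph :=
  SGraph (@induced_sym S) (@induced_irrefl S).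

(* The guard [u != v] only matters when [x = y], where nothing is added. *)
Definition add_edge_rel (x y : G) : rel G :=
  fun u v => adj u v || ((u != v) && ([set u; v] == [set x; y])).

Lemma add_edge_sym (x y : G) : symmetric (add_edge_rel x y).
Proof. by move=> u v; rewrite /add_edge_rel adj_sym eq_sym setUC. Qed.

Lemma add_edge_irrefl (x y : G) : irreflexive (add_edge_rel x y).
Proof. by move=> u; rewrite /add_edge_rel adj_irrefl eqxx. Qed.

Definition add_edge (x y : G) : sgraph :=
  SGraph (@add_edge_sym x y) (@add_edge_irrefl x y).

End Constructions.

Definition triangle_free (G : sgraph) : Prop :=
  ~ exists x y z : G, [&& adj x y, adj y z & adj x z].

Definition maximal_triangle_free (G : sgraph) : Prop :=
  triangle_free G /\
  forall x y : G, x != y -> ~~ adj x y -> ~ triangle_free (add_edge x y).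

Definition colorable (G : sgraph) (k : nat) : bool :=
  [exists f : {ffun G -> 'I_k}, forall x, forall y, adj x y ==> (f x != f y)].

Lemma colorable_ex (G : sgraph) : exists k, colorable G k.
Proof.
exists #|G|; apply/existsP; exists [ffun x => enum_rank x].
apply/forallP=> x; apply/forallP=> y; apply/implyP=> xy; rewrite !ffunE.
by apply: contraTneq xy => /enum_rank_inj ->; rewrite adj_irrefl.
Qed.

Definition chromatic_number (G : sgraph) : nat := ex_minn (colorable_ex G).

(* [b] places the vertices of [F] in [H], and [p u v] lists, from [u] to [v],
   the internal vertices of the path replacing the edge [uv] of [F]; this list
   is empty when the edge is kept. Values of [p] off the edges are ignored. *)
Definition subdivision (F H : sgraph) : Prop :=
  exists (b : F -> H) (p : F -> F -> seq H),
  [/\ injective b,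
      forall u v, adj u v ->
        [/\ p v u = rev (p u v), uniq (p u v) & forall w, b w \notin p u v],
      forall u v u' v' x, adj u v -> adj u' v' ->
        x \in p u v -> x \in p u' v' -> [set u; v] = [set u'; v'],
      forall x, (exists u, x = b u) \/ exists u v, adj u v /\ x \in p u v
    & forall x y, adj x y <->
        exists u v, adj u v /\ infix [:: x; y] (b u :: rcons (p u v) (b v))].

Definition has_induced_subdivision (F G : sgraph) : Prop :=
  exists (S : {set G}) (H : sgraph),
    subdivision F H /\ isomorphic (induced S) H.

(* Main.v *)
Require Import Defs.
From mathcomp Require Import all_boot all_order all_algebra zify.
From mathcomp Require Import reals sequences exp.

(** Let G be maximal triangle-free with large chromatic number, and let F have l
    vertices. Two nonadjacent vertices of G have a common neighbour. It suffices
    to find in G an induced 1-subdivision of the complete bipartite graph with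
    sides F and F * F ([biclique_subdivision]): pairwise nonadjacent branch
    vertices and, for each edge, a subdividing vertex adjacent to its two ends
    and to no other branch vertex, these subdividing vertices being pairwise
    nonadjacent too.

    By a multiplicative weights argument ([heavy_or_light]) one of two cases
    holds, for a parameter q = 2 ^ O(l ^ 4).

    - Some probability distribution gives every neighbourhood mass at least
      1 / (2 q). A set S that meets all neighbourhoods gives a colouring with #|S|
      colours, so there is no such S of size 2 ^ O(l ^ 4). An epsilon-net argument
      ([heavy_shatters]) based on Pajor's lemma then shows that the neighbourhoods
      shatter a set with more than l + l ^ 2 vertices, from which the subdivided
      biclique is read off ([shattered_biclique]).

    - Some probability distribution gives every neighbourhood mass at most 2 / q.
      Independent random branch vertices, with a fixed choice of common neighbours as
      subdividing vertices, then satisfy every condition with large probability,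
      except that subdividing vertices may be adjacent ([private_sample]). If such
      adjacencies are rare they are avoided as well. Otherwise one vertex v is
      adjacent to the common neighbours of a fraction 1 / l ^ O(1) of all pairs; with
      probability at least 2 ^ - O(l ^ 4) all the subdividing vertices of the sample are
      neighbours of v, and neighbours of v are pairwise nonadjacent
      ([light_biclique]). *)

Set Implicit Arguments.
Unset Strict Implicit.
Unset Printing Implicit Defensive.

(** * Counting over finite sample spaces *)

Lemma sum_boolE (T : finType) (P : pred T) : \sum_x (P x : nat) = #|P|.
Proof.
rewrite -sum1_card [RHS]big_mkcond; apply: eq_bigr => x _.
by rewrite unfold_in; case: (P x).
Qed.

(** The map (s, b) |-> (upd s b, get s) is an involution of S * B, so replacing
    the part of a uniform sample read by get with an independent value leaves
    the sample uniform. *)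
Lemma card_resample (S B : finType) (upd : S -> B -> S) (get : S -> B)
    (P : pred S) :
    (forall s b, upd (upd s b) (get s) = s) ->
    (forall s b, get (upd s b) = b) ->
  #|P| * #|B| = \sum_s #|[pred b | P (upd s b)]|.
Proof.
move=> updK get_upd.
have swapK : involutive (fun sb : S * B => (upd sb.1 sb.2, get sb.1)).
  by case=> s b /=; rewrite updK get_upd.
under eq_bigr do rewrite -sum_boolE.
rewrite pair_big /= (reindex_inj (inv_inj swapK)) /=.
under eq_bigr do rewrite updK.
rewrite -(pair_big xpredT xpredT (fun s (_ : B) => P s : nat)) /=.
by under eq_bigr do rewrite sum_nat_const; rewrite -big_distrr /= sum_boolE mulnC.
Qed.

(** The law of total probability: an event whose conditional probability, given
    everything except the part read by get, is always at most c / m has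
    probability at most c / m. *)
Lemma resample_bound (S B : finType) (upd : S -> B -> S) (get : S -> B)
    (P : pred S) (m c : nat) :
    (forall s b, upd (upd s b) (get s) = s) ->
    (forall s b, get (upd s b) = b) ->
    (forall s, #|[pred b | P (upd s b)]| * m <= c * #|B|) ->
  #|P| * m <= c * #|S|.
Proof.
move=> updK get_upd Pm.
have [B0|B0] := posnP #|B|.
  suff -> : #|P| = 0 by [].
  by apply: eq_card0 => s; have := card0_eq B0 (get s).
rewrite -(leq_pmul2r B0) mulnAC (card_resample P updK get_upd) big_distrl /=.
apply: leq_trans (leq_sum _ (fun s _ => Pm s)) _.
by rewrite sum_nat_const mulnCA mulnA.
Qed.

Definition fupd (I B : finType) (s : {ffun I -> B}) (i : I) (b : B) :
  {ffun I -> B} := [ffun j => if j == i then b else s j].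

Lemma fupdK (I B : finType) i (s : {ffun I -> B}) b :
  fupd (fupd s i b) i (s i) = s.
Proof. by apply/ffunP=> j; rewrite !ffunE; case: eqP => [->|]. Qed.

Lemma fupdE (I B : finType) i (s : {ffun I -> B}) b : fupd s i b i = b.
Proof. by rewrite ffunE eqxx. Qed.

Lemma fupd_neq (I B : finType) i (s : {ffun I -> B}) b j :
  j != i -> fupd s i b j = s j.
Proof. by rewrite ffunE => /negbTE->. Qed.

Lemma union_bound (S E : finType) (A : pred S) (P : E -> pred S) :
  \sum_e #|P e| < #|A| -> exists2 s, A s & forall e, ~~ P e s.
Proof.
move=> lt_sum.
case: (boolP [exists s in A, [forall e, ~~ P e s]]) => [/exists_inP[s As]|].
  by move/forallP=> Ps; exists s.
move/exists_inPn=> noA.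
move: lt_sum; rewrite ltnNge => /negP[].
under eq_bigr do rewrite -sum_boolE.
rewrite exchange_big -sum1_card big_mkcond; apply: leq_sum => s _.
case: ifP => // /noA /forallPn[e]; rewrite negbK => Pes.
by rewrite (bigD1 e) //= Pes.
Qed.

Lemma leq_expn2r (x y k : nat) : x <= y -> x ^ k <= y ^ k.
Proof. by move=> xy; elim: k => // k IHk; rewrite !expnS leq_mul. Qed.

Lemma rearrangement (x y p q : nat) :
  x <= y -> p <= q -> x * q + y * p <= x * p + y * q.
Proof. by move=> /subnKC <- /subnKC <-; nia. Qed.

(** The power mean inequality, cleared of denominators: the mean of d being at
    least n / h, the mean of d ^ k is at least (n / h) ^ k. The induction on k
    is Chebyshev's sum inequality for d and d ^ k. *)
Lemma power_mean (A : finType) (d : A -> nat) (n h k : nat) :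
  #|A| * n <= h * \sum_a d a -> #|A| * n ^ k <= h ^ k * \sum_a d a ^ k.
Proof.
move=> hyp; have [A0|A0] := posnP #|A|; first by rewrite A0.
elim: k => [|k IHk].
  by under eq_bigr do rewrite expn0; rewrite sum_nat_const !expn0 mul1n cardT.
have cheb : (\sum_a d a) * (\sum_a d a ^ k) <= #|A| * \sum_a d a ^ k.+1.
  have swap : \sum_a \sum_b d a * d b ^ k = \sum_a \sum_b d b * d a ^ k.
    exact: exchange_big.
  have L : (\sum_a d a) * (\sum_a d a ^ k) = \sum_a \sum_b d a * d b ^ k.
    by rewrite big_distrl; apply: eq_bigr => a _; rewrite big_distrr.
  have R1 : #|A| * \sum_a d a ^ k.+1 = \sum_a \sum_(b : A) d a ^ k.+1.
    by rewrite big_distrr; apply: eq_bigr => a _; rewrite sum_nat_const.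
  have R2 : #|A| * \sum_a d a ^ k.+1 = \sum_(a : A) \sum_b d b ^ k.+1.
    by rewrite sum_nat_const.
  suff : \sum_a \sum_b (d a * d b ^ k + d b * d a ^ k)
      <= \sum_a \sum_b (d a ^ k.+1 + d b ^ k.+1).
    under eq_bigr do rewrite big_split /=; rewrite big_split /= -swap -L.
    under [X in _ <= X -> _]eq_bigr do rewrite big_split /=.
    by rewrite big_split /= -R1 -R2 !addnn leq_double.
  apply: leq_sum => a _; apply: leq_sum => b _; rewrite !expnS.
  have [ab|/ltnW ba] := leqP (d a) (d b).
    exact: rearrangement ab (leq_expn2r k ab).
  rewrite addnC [X in _ <= X]addnC; exact: rearrangement ba (leq_expn2r k ba).
set p := \sum_a d a ^ k in IHk cheb; set r := \sum_a d a ^ k.+1 in cheb *.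
have np_hr : n * p <= h * r.
  rewrite -(leq_pmul2l A0) mulnA mulnCA.
  apply: leq_trans (leq_mul hyp (leqnn p)) _.
  by rewrite -mulnA leq_mul2l cheb orbT.
rewrite !expnS mulnCA; apply: leq_trans (leq_mul (leqnn n) IHk) _.
by rewrite mulnCA -mulnA [leqRHS]mulnCA leq_mul2l np_hr orbT.
Qed.

(** * Shattered sets *)

Section Pajor.
Variable V : finType.
Implicit Types (A : {set {set V}}) (X Z E U : {set V}).

Definition shatters A X :=
  [forall Z : {set V}, (Z \subset X) ==> [exists E in A, E :&: X == Z]].

Lemma shattersP A X :
  reflect (forall Z, Z \subset X -> exists2 E, E \in A & E :&: X = Z) (shatters A X).
Proof.
apply: (iffP forallP) => [sAX Z ZX|sAX Z].
  by have /implyP/(_ ZX)/exists_inP[E EA /eqP] := sAX Z; exists E.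
by apply/implyP=> /sAX[E EA <-]; apply/exists_inP; exists E.
Qed.

(** Pajor's form of the Sauer-Shelah lemma. Split A by membership of a point x
    on which two members disagree. Sets shattered by either half avoid x and are
    shattered by A; if X is shattered by both halves then x |: X is shattered by
    A as well, and these extra sets contain x. Hence A shatters at least as many
    sets as the two halves do together, and induction applies. *)
Lemma pajor A : #|A| <= #|[set X | shatters A X]|.
Proof.
have [n] := ubnP #|A|; elim: n A => // n IHn A An.
have [A1|A1] := leqP #|A| 1.
  case: (posnP #|A|) => [-> //|A0]; apply: leq_trans A1 _.
  have [E EA] := card_gt0P A0.
  apply/card_gt0P; exists set0; rewrite inE; apply/shattersP=> Z.
  by rewrite subset0 => /eqP->; exists E; rewrite ?setI0.
have [E1 [E2 [E1A E2A neqE]]] : exists E1 E2, [/\ E1 \in A, E2 \in A & E1 != E2].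
  by have [E1 [E2 [? ? ?]]] := card_gt1P A1; exists E1, E2.
have [x] : exists x, x \in E1 :\: E2 :|: E2 :\: E1.
  apply/set0Pn; apply: contra neqE; rewrite setU_eq0 !setD_eq0 => /andP[s12 s21].
  by rewrite eqEsubset s12.
move=> xE12.
pose A1' := [set E : {set V} in A | x \in E].
pose A0' := [set E : {set V} in A | x \notin E].
have cardA : #|A1'| + #|A0'| = #|A|.
  rewrite -[RHS](cardsID [set E : {set V} | x \in E]); congr (_ + _); apply: eq_card => E.
    by rewrite !inE.
  by rewrite !inE andbC.
have [A1'0 A0'0] : 0 < #|A1'| /\ 0 < #|A0'|.
  move: xE12; rewrite !inE => /orP[]/andP[? ?]; split; apply/card_gt0P;
    by [exists E1; rewrite inE; apply/andP | exists E2; rewrite inE; apply/andP].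
have lt1 : #|A1'| < n by lia.
have lt0 : #|A0'| < n by lia.
have := leq_add (IHn _ lt1) (IHn _ lt0); rewrite cardA => /leq_trans; apply.
set S1 := [set X | _]; set S0 := [set X | _].
have xS1 X : X \in S1 -> x \notin X.
  rewrite inE => /shattersP/(_ _ (sub0set X))[E]; rewrite inE => /andP[_ xE] EX.
  by apply/negP=> xX; have : x \in E :&: X by [rewrite inE xE]; rewrite EX inE.
have xS0 X : X \in S0 -> x \notin X.
  rewrite inE => /shattersP/(_ _ (subxx _))[E]; rewrite inE => /andP[_ xE] EX.
  by apply/negP; rewrite -EX inE (negbTE xE).
have injx : {in S1 :&: S0 &, injective (fun X => x |: X)}.
  move=> X Y /setIP[/xS1 xX _] /setIP[/xS1 xY _] /setP eqXY.
  apply/setP=> z; have := eqXY z; rewrite !inE; case: eqP => // -> _.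
  by rewrite (negbTE xX) (negbTE xY).
rewrite -cardsUI -(card_in_imset injx) -cardsUI.
set I := [set _ | _ in _].
have -> : (S1 :|: S0) :&: I = set0.
  apply/setP=> X; rewrite in_set0; apply/negbTE/negP; rewrite in_setI.
  case/andP=> XS /imsetP[Y _ XY]; move: XS; rewrite XY in_setU.
  by case/orP=> [/xS1|/xS0]; rewrite setU11.
rewrite cards0 addn0; apply: subset_leq_card; apply/subsetP=> X.
rewrite in_setU => /orP[|/imsetP[Y]].
  rewrite in_setU => /orP[] /[!inE] /shattersP sX; apply/shattersP=> Z /sX[E];
    by rewrite inE => /andP[EA _]; exists E.
rewrite in_setI => /andP[Y1 Y0] ->; rewrite inE; apply/shattersP=> Z ZxY.
have ZDY : Z :\ x \subset Y by rewrite subDset.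
have [xZ|xZ] := boolP (x \in Z).
  move: Y1; rewrite inE => /shattersP/(_ _ ZDY)[E] /[!inE] /andP[EA xE] EY.
  exists E => //; rewrite setIUr EY.
  by rewrite (setIidPr _) ?sub1set // setD1K.
move: Y0; rewrite inE => /shattersP/(_ _ ZDY)[E] /[!inE] /andP[EA xE] EY.
exists E => //; rewrite setIUr EY.
have -> : E :&: [set x] = set0 by apply/eqP; rewrite setI_eq0 disjoint_sym disjoints1.
by rewrite set0U; apply/setP=> z; rewrite !inE; case: eqP => // ->; rewrite (negbTE xZ).
Qed.

Lemma shatters_subset A U X :
  (forall E, E \in A -> E \subset U) -> shatters A X -> X \subset U.
Proof.
move=> AU /shattersP/(_ _ (subxx X))[E /AU EU EX].
by rewrite -EX; apply: subset_trans EU; apply: subsetIl.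
Qed.

(** A set of at most s points of U is the range of a partial function from 'I_s
    to U. *)
Lemma card_small_subsets (U : {set V}) s :
  #|[set X : {set V} | (X \subset U) && (#|X| <= s)]| <= #|U|.+1 ^ s.
Proof.
pose f (g : {ffun 'I_s -> option {x : V | x \in U}}) : {set V} :=
  [set x | [exists i, omap val (g i) == Some x]].
apply: (@leq_trans #|f @: [set: {ffun 'I_s -> option {x : V | x \in U}}]|).
  apply: subset_leq_card; apply/subsetP=> X; rewrite inE => /andP[XU Xs].
  apply/imsetP; exists [ffun i : 'I_s => obind insub (onth (enum X) i)] => //.
  apply/setP=> x; rewrite inE; apply/idP/existsP.
    move=> xX; have ix : index x (enum X) < #|X| by rewrite cardE index_mem mem_enum.
    exists (Ordinal (leq_trans ix Xs)); rewrite ffunE /=.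
    rewrite onthE (nth_map x) -?cardE //= nth_index ?mem_enum //.
    by rewrite insubT ?(subsetP XU).
  case=> i; rewrite ffunE onthE => fi; rewrite -mem_enum.
  have [iX|iX] := ltnP i (size (enum X)); last first.
    by move: fi; rewrite nth_default ?size_map.
  move: fi; rewrite (nth_map x) //=; case: insubP => //= y _ -> /eqP[<-].
  exact: mem_nth.
apply: leq_trans (leq_imset_card _ _) _.
by rewrite cardsT card_ffun card_option card_sig card_ord.
Qed.
End Pajor.

(** * Heavy neighbourhoods: a small hitting set or a large shattered set *)

Lemma bernoulli (x h n : nat) : x ^ n * (x + n * h) <= (x + h) ^ n * x.
Proof.
elim: n => [|n IHn]; first by rewrite addn0.
rewrite !expnS -[leqRHS]mulnA.
apply: leq_trans (leq_mul (leqnn (x + h)) IHn).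
rewrite -mulnA [leqLHS]mulnCA [leqRHS]mulnCA leq_mul2l; apply/orP; right.
by nia.
Qed.

(** In probabilistic terms: if an event has probability at least 1 / m, then
    m * n independent trials all miss it with probability at most 2 ^ - n. *)
Lemma sparse_power (x h m n : nat) :
  0 < m -> x + h <= m * h -> x ^ (m * n) * 2 ^ n <= (x + h) ^ (m * n).
Proof.
move=> m0 xh; rewrite !expnM -expnMn; apply: leq_expn2r.
have [->|x0] := posnP x; first by rewrite exp0n.
rewrite -(leq_pmul2r x0); apply: leq_trans (bernoulli x h m).
by rewrite -mulnA leq_mul2l mul2n -addnn; apply/orP; right; lia.
Qed.

(** An epsilon-net argument. Draw D independent blocks of M points each. For a
    set I of blocks, let w_I be an element whose neighbourhood misses every
    point of the blocks in I; it exists because these points are few. As w_I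
    does not depend on the blocks outside I and its neighbourhood is heavy, with
    high probability it hits each of them. The 2 ^ D neighbourhoods then have distinct
    traces on the at most D * M sampled points, and Pajor's lemma yields a large
    shattered set. *)
Section Net.
Variables (W V O : finType) (r : W -> V -> bool) (pt : O -> V) (m D s : nat).
Hypothesis O_gt0 : 0 < #|O|.
Hypothesis heavy : forall w, #|O| <= m * #|[pred o | r w (pt o)]|.
Hypothesis D_large : (2 * m * D ^ 2).+1 ^ s < 2 ^ D.
Hypothesis escape : forall S : {set V}, #|S| <= 2 * m * D ^ 2 ->
  exists w, forall x, x \in S -> ~~ r w x.

(* With 2 * D halvings per block, the failure probability 2 ^ - (2 * D) beats
   the 2 ^ D * D events of the union bound. *)
Let M := m * (2 * D).

Let sample := {ffun 'I_D -> {ffun 'I_M -> O}}.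

Definition block_points (t : sample) (I : {set 'I_D}) : {set V} :=
  [set pt (t p.1 p.2) | p in setX I [set: 'I_M]].

Lemma block_pointsP (t : sample) (I : {set 'I_D}) x :
  reflect (exists2 i, i \in I & exists a, x = pt (t i a)) (x \in block_points t I).
Proof.
apply: (iffP imsetP) => [[[i a] /setXP[iI _] ->]|[i iI [a ->]]].
  by exists i => //; exists a.
by exists (i, a); rewrite // in_setX iI inE.
Qed.

Lemma card_block_points t I : #|block_points t I| <= 2 * m * D ^ 2.
Proof.
apply: leq_trans (leq_imset_card _ _) _; rewrite cardsX cardsT card_ord.
have := max_card (mem I); rewrite card_ord /M.
set i := #|_| => iD; apply: leq_trans (leq_mul iD (leqnn _)) _.
by rewrite mulnA -mulnn; lia.
Qed.

Lemma heavy_shatters : exists2 X : {set V}, s < #|X| &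
  forall Z : {set V}, Z \subset X -> exists w, forall x, x \in X -> r w x = (x \in Z).
Proof.
have D0 : 0 < D by move: D_large; case: (D) => //; rewrite expn0 ltnS leqn0 expn_eq0.
have [w0 _] : exists w, forall x, x \in (set0 : {set V}) -> ~~ r w x.
  by apply: escape; rewrite cards0.
have m0 : 0 < m by move: (heavy w0); case: (m) => //; lia.
have escape_or (S : {set V}) : exists w,
    #|S| <= 2 * m * D ^ 2 -> forall x, x \in S -> ~~ r w x.
  have [/escape[w wS]|_] := leqP #|S| (2 * m * D ^ 2); last by exists w0.
  by exists w.
have [sel selP] := fin_all_exists escape_or.
have card_sets : #|{set 'I_D}| = 2 ^ D.
  by rewrite -cardsT -powersetT card_powerset cardsT card_ord.
pose bad (e : {set 'I_D} * 'I_D) (t : sample) := (e.2 \notin e.1) &&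
  [forall a, ~~ r (sel (block_points t e.1)) (pt (t e.2 a))].
have bad_rare e : #|bad e| * 2 ^ (2 * D) <= 1 * #|{: sample}|.
  case: e => I j.
  apply: (@resample_bound _ _ (fun t b => fupd t j b) (fun t => t j)) => [t b|t b|t].
  - exact: fupdK.
  - exact: fupdE.
  rewrite mul1n /bad /=; have [jI|jI] := boolP (j \in I).
    by rewrite eq_card0.
  set w := sel (block_points t I).
  pose miss := [pred o | ~~ r w (pt o)].
  have -> : #|[pred b | true && [forall a, ~~ r (sel (block_points (fupd t j b) I))
      (pt (fupd t j b j a))]]| = #|miss| ^ M.
    rewrite -[in RHS](card_ord M) -card_ffun_on; apply: eq_card => b.
    rewrite !inE; apply: eq_forallb => a; rewrite fupdE.
    suff -> : block_points (fupd t j b) I = block_points t I by [].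
    apply: eq_in_imset => -[i a'] /setXP[iI _] /=.
    by rewrite fupd_neq //; apply: contraNneq jI => <-.
  have missE : #|miss| + #|[pred o | r w (pt o)]| = #|O|.
    by rewrite addnC -(cardC [pred o | r w (pt o)]).
  by rewrite card_ffun card_ord -missE; apply: sparse_power; rewrite ?missE.
have [t _ good] : exists2 t, xpredT t & forall e, ~~ bad e t.
  apply: union_bound.
  have tot : #|{: sample}| > 0 by rewrite !card_ffun expn_gt0 expn_gt0 O_gt0.
  rewrite -(ltn_pmul2r (_ : 0 < 2 ^ (2 * D))) ?expn_gt0 //.
  rewrite big_distrl; apply: leq_ltn_trans (leq_sum _ (fun e _ => bad_rare e)) _.
  rewrite sum_nat_const mul1n card_prod card_sets card_ord mulnC ltn_pmul2l //.
  by rewrite mul2n -addnn expnD ltn_pmul2l ?expn_gt0 // ltn_expl.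
pose tr I := [set v in block_points t setT | r (sel (block_points t I)) v].
have tr_inj : injective tr.
  move=> I J; move: I J; suff H I J : tr I = tr J -> J \subset I.
    by move=> I J e; apply/eqP; rewrite eqEsubset !H.
  move=> eqIJ; apply/subsetP=> j jJ; apply/negPn/negP=> jI.
  have := good (I, j); rewrite /bad /= jI => /forallPn[a]; rewrite negbK => rI.
  have : pt (t j a) \in tr I.
    by rewrite inE rI andbT; apply/block_pointsP; exists j; last exists a.
  rewrite eqIJ inE => /andP[_]; apply/negP.
  apply: selP (card_block_points _ _) _ _.
  by apply/block_pointsP; exists j; last exists a.
pose fam := tr @: setT.
have cardfam : #|fam| = 2 ^ D by rewrite card_imset // cardsT card_sets.
have [/exists_inP[X]|/exists_inPn noX] :=
    boolP [exists X in [set X | shatters fam X], s < #|X|]; last first.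
  have U_small : #|block_points t setT|.+1 <= (2 * m * D ^ 2).+1.
    exact: card_block_points.
  have := leq_ltn_trans (card_small_subsets (block_points t setT) s)
    (leq_ltn_trans (leq_expn2r s U_small) D_large).
  rewrite ltnNge -cardfam => /negP[].
  apply: leq_trans (pajor fam) _; apply: subset_leq_card; apply/subsetP=> X XS.
  have := noX X XS; rewrite -leqNgt inE => ->; rewrite andbT.
  move: XS; rewrite inE; apply: shatters_subset => E /imsetP[I _ ->].
  by apply/subsetP=> v; rewrite inE => /andP[].
rewrite inE => XS sX; exists X => // Z ZX.
have XU : X \subset block_points t setT.
  apply: shatters_subset XS => E /imsetP[I _ ->].
  by apply/subsetP=> v; rewrite inE => /andP[].
have /shattersP/(_ Z ZX)[E /imsetP[I _ ->] <-] := XS.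
exists (sel (block_points t I)) => x xX.
by rewrite !inE xX (subsetP XU) // andbT.
Qed.
End Net.

(** * Heavy or light: reweighting *)

Lemma reverse_bernoulli (m k : nat) : m.+1 ^ k * (m.+1 - k) <= m ^ k * m.+1.
Proof.
elim: k => [|k IHk]; first by rewrite subn0.
apply: (@leq_trans (m * (m.+1 ^ k * (m.+1 - k)))); last first.
  by rewrite expnS -mulnA leq_mul2l IHk orbT.
rewrite expnS -mulnA mulnCA [leqRHS]mulnCA leq_mul2l; apply/orP; right.
by nia.
Qed.

(** One q-th of a halving: (1 + 1 / (2 q)) ^ q <= 2, by [reverse_bernoulli]. *)
Lemma slow_power_growth q L : (2 * q).+1 ^ (q * L) <= 2 ^ L * (2 * q) ^ (q * L).
Proof.
rewrite !expnM -expnMn; apply: leq_expn2r.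
have := reverse_bernoulli (2 * q) q; set x := (2 * q).+1 ^ q; set y := (2 * q) ^ q.
rewrite -(leq_pmul2r (ltn0Sn (2 * q))) => h; nia.
Qed.

(** A substitute for linear programming duality. Think of r w v as: w covers v.
    Either some probability distribution on V gives every neighbourhood of an
    element of W mass at least 1 / (2 q), or some distribution on W gives every
    neighbourhood of an element of V mass at most 2 / q. Distributions are
    represented as images of the uniform one, from an auxiliary finite type. *)
Section HeavyLight.
Variables (W V : finType) (r : W -> V -> bool) (q : nat).
Hypothesis q_gt0 : 0 < q.
Hypothesis V_gt0 : 0 < #|V|.

Definition heavy_weight (wt : V -> nat) :=
  [forall w, \sum_v wt v <= 2 * q * \sum_(v | r w v) wt v].

(** Multiplicative weights: start from weight 1 and, as long as some w covers
    less than the fraction 1 / (2 q) of the total weight, record w and double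
    the weight of what it covers. Each round multiplies the total by less than
    1 + 1 / (2 q), while the weight of v is 2 to the number of recorded elements
    covering v. *)
Lemma reweighting t :
  (exists2 wt, 0 < \sum_v wt v & heavy_weight wt) \/
  exists2 ws : seq W, size ws = t &
    (\sum_v 2 ^ count (r^~ v) ws) * (2 * q) ^ t <= #|V| * (2 * q).+1 ^ t.
Proof.
elim: t => [|t [IH|[ws szws IH]]]; [right | by left | ].
  by exists [::] => //; under eq_bigr do rewrite /= expn0; rewrite sum1_card muln1 cardT.
pose wt v := 2 ^ count (r^~ v) ws.
have [hwt|/forallPn[w]] := boolP (heavy_weight wt).
  left; exists wt => //; have [v _] := card_gt0P V_gt0.
  by rewrite (bigD1 v) //= addn_gt0 expn_gt0.
rewrite -ltnNge => lt_w; right; exists (w :: ws); rewrite /= ?szws //.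
have -> : \sum_v 2 ^ (r w v + count (r^~ v) ws) =
    \sum_v wt v + \sum_(v | r w v) wt v.
  rewrite [X in _ + X]big_mkcond -big_split /=; apply: eq_bigr => v _.
  by rewrite /wt; case: (r w v); rewrite ?addn0 // add1n expnS mul2n addnn.
apply: (@leq_trans ((2 * q).+1 * ((\sum_v wt v) * (2 * q) ^ t))).
  rewrite expnS; move: lt_w; set x := \sum_v wt v; set y := \sum_(v | _) _.
  move=> lt_w; rewrite mulnA [leqRHS]mulnA leq_mul2r; apply/orP; right; lia.
by rewrite [(2 * q).+1 ^ _]expnS [leqRHS]mulnCA leq_mul2l IH orbT.
Qed.

Lemma heavy_or_light :
  (exists (O : finType) (pt : O -> V), 0 < #|O| /\
     forall w, #|O| <= 2 * q * #|[pred o | r w (pt o)]|) \/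
  (exists (O : finType) (pt : O -> W), 0 < #|O| /\
     forall v, #|[pred o | r (pt o) v]| * q <= 2 * #|O|).
Proof.
have [[wt wt0 /forallP hwt]|[ws szws small]] := reweighting (q * #|V|); [left|right].
  (* Weighted points become points repeated according to their weight. *)
  pose O : finType := {v : V & 'I_(wt v)}; exists O, (@tag _ _).
  have cardO (P : pred V) : #|[pred o : O | P (tag o)]| = \sum_(v | P v) wt v.
    rewrite -sum1_card; under [RHS]eq_bigr => v _ do
      rewrite -[wt v]card_ord -sum1_card.
    rewrite sig_big_dep /=; apply: eq_bigl => o; by rewrite andbT.
  have cardO' : #|O| = \sum_v wt v.
    by rewrite -(cardO xpredT); apply: eq_card.
  split=> [|w]; first by rewrite cardO'.
  by rewrite cardO' (cardO (r w)).
exists 'I_(size ws), (tnth (in_tuple ws)); split=> [|v].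
  by rewrite card_ord szws muln_gt0 q_gt0.
have -> : #|[pred o | r (tnth (in_tuple ws) o) v]| = count (r^~ v) ws.
  by rewrite -sum1_count big_tnth sum1_card.
rewrite card_ord szws mulnC mulnCA leq_pmul2l //.
rewrite -(@leq_exp2l 2) //; set N := q * #|V|.
rewrite -(leq_pmul2r (_ : 0 < (2 * q) ^ N)) ?expn_gt0 ?muln_gt0 ?q_gt0 //.
apply: (@leq_trans (#|V| * (2 * q).+1 ^ N)).
  apply: leq_trans small; rewrite leq_mul2r; apply/orP; right.
  by rewrite (bigD1 v) //= leq_addr.
have V_exp : #|V| <= 2 ^ #|V| by rewrite ltnW // ltn_expl.
have := leq_mul V_exp (slow_power_growth q #|V|); rewrite -/N => /leq_trans; apply.
by rewrite mulnA -expnD addnn -mul2n.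
Qed.
End HeavyLight.

(** * From a subdivided biclique to a subdivision of F *)

Lemma infix_map_inj (T U : eqType) (f : T -> U) (s1 s2 : seq T) :
  injective f -> infix (map f s1) (map f s2) = infix s1 s2.
Proof.
move=> inj_f.
have inj_map := inj_map inj_f.
elim: s2 => [|x s2 IHs]; first by case: s1.
rewrite [map f (x :: s2)]/= !infix_consl IHs; congr (_ || _).
rewrite -[f x :: _]/(map f (x :: s2)).
by rewrite !prefixE size_map -map_take (inj_eq inj_map).
Qed.

Section InducedSubdivision.
Variables (F G : sgraph) (b : F -> G) (p : F -> F -> seq G).

Definition subdivision_support : {set G} :=
  [set x | [exists u, x == b u] || [exists u, exists v, adj u v && (x \in p u v)]].

Let S := subdivision_support.

Lemma supportP x :
  reflect ((exists u, x = b u) \/ exists u v, adj u v /\ x \in p u v) (x \in S).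
Proof.
rewrite inE; apply: (iffP orP) => -[].
- by case/existsP=> u /eqP; left; exists u.
- by case/existsP=> u /existsP[v /andP[]]; right; exists u, v.
- by case=> u ->; left; apply/existsP; exists u.
- case=> u [v [uv xp]]; right; apply/existsP; exists u; apply/existsP; exists v.
  exact/andP.
Qed.

(** A subdivision can be described inside G: the adjacency condition on the
    support says that the subgraph it induces is the subdivision, and the lists
    of internal vertices are then transported to that subgraph. *)
Lemma has_induced_subdivisionI :
    injective b ->
    (forall u v, adj u v ->
      [/\ p v u = rev (p u v), uniq (p u v) & forall w, b w \notin p u v]) ->
    (forall u v u' v' x, adj u v -> adj u' v' ->
      x \in p u v -> x \in p u' v' -> [set u; v] = [set u'; v']) ->
    (forall x y, x \in S -> y \in S ->
      adj x y <-> exists u v, adj u v /\ infix [:: x; y] (b u :: rcons (p u v) (b v))) ->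
  has_induced_subdivision F G.
Proof.
move=> inj_b p_path p_disj adjE.
have bS u : b u \in S by apply/supportP; left; exists u.
pose b' u : induced S := Sub (b u) (bS u).
pose p' u v : seq (induced S) := pmap insub (p u v).
have p'K u v : adj u v -> map val (p' u v) = p u v.
  move=> uv; rewrite (pmap_filter (insubK _)) //; apply/all_filterP/allP=> x xp /=.
  by rewrite isSome_insub; apply/supportP; right; exists u, v.
have mem_p' u v x : adj u v -> (x \in p' u v) = (val x \in p u v).
  by move=> uv; rewrite -(p'K u v uv) mem_map //; apply: val_inj.
exists S, (induced S); split; last by exists id; split => //; exists id.
exists b', p'; split.
- by move=> u v [/inj_b].
- move=> u v uv; have [pr pu pb] := p_path u v uv; split.
  + by apply: (inj_map val_inj); rewrite map_rev !p'K // adj_sym.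
  + by rewrite -(map_inj_uniq val_inj) p'K.
  + by move=> w; rewrite mem_p' //; apply: pb.
- move=> u v u' v' x uv uv'; rewrite !mem_p' //; exact: p_disj.
- move=> x; have /supportP[[u xb]|[u [v [uv xp]]]] := valP x.
    by left; exists u; apply: val_inj.
  by right; exists u, v; rewrite mem_p'.
- move=> x y; apply: iff_trans (adjE _ _ (valP x) (valP y)) _.
  have infE u v : adj u v ->
      infix [:: x; y] (b' u :: rcons (p' u v) (b' v)) =
      infix [:: val x; val y] (b u :: rcons (p u v) (b v)).
    by move=> uv; rewrite -(infix_map_inj _ _ val_inj) /= map_rcons p'K.
  by split=> -[u [v [uv H]]]; exists u, v; split=> //; [rewrite infE | rewrite infE in H].
Qed.
End InducedSubdivision.

(** G contains as an induced subgraph the 1-subdivision of the complete bipartite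
    graph with sides A and B: w gives the branch vertices, and y a b is the
    subdividing vertex of the edge ab. *)
Definition induced_subdivided_biclique (A B : finType) (G : sgraph) : Prop :=
  exists (w : A + B -> G) (y : A -> B -> G),
  [/\ injective w, forall c d, ~~ adj (w c) (w d),
      forall a b c, adj (y a b) (w c) = (c == inl a) || (c == inr b)
    & forall a b a' b', ~~ adj (y a b) (y a' b')].

(** A canonical orientation of the pair, so that uv and vu name the same vertex
    of the second side of the biclique. *)
Definition ordered_pair (T : finType) (u v : T) : T * T :=
  if enum_rank u <= enum_rank v then (u, v) else (v, u).

Lemma ordered_pairC (T : finType) (u v : T) : ordered_pair u v = ordered_pair v u.
Proof.
rewrite /ordered_pair; case: ltngtP => // /val_inj /enum_rank_inj -> //.
Qed.

Lemma ordered_pair_set (T : finType) (u v u' v' : T) :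
  ordered_pair u v = ordered_pair u' v' -> [set u; v] = [set u'; v'].
Proof.
by rewrite /ordered_pair; case: ifP; case: ifP => _ _ [-> ->] //; rewrite setUC.
Qed.

(** The 1-subdivision of the biclique with sides F and F * F contains the
    3-subdivision of F: the edge uv becomes the path u, y u e, e, y v e, v, where
    e is the vertex of the second side named by the pair uv. The orientation
    makes the path from v to u the reverse of the one from u to v. *)
Lemma biclique_subdivision (F G : sgraph) :
  induced_subdivided_biclique F (F * F)%type G -> has_induced_subdivision F G.
Proof.
case=> w [y [inj_w ww yw yy]].
have wy c a b : adj (w c) (y a b) = (c == inl a) || (c == inr b) by rewrite adj_sym yw.
have y_w a b c : y a b <> w c.
  by move=> ey; have := ww c (inl a); rewrite -ey yw eqxx.
have inj_y a b a' b' : y a b = y a' b' -> a = a' /\ b = b'.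
  move=> ey; have := yw a b (inl a'); have := yw a b (inr b').
  rewrite ey !yw !eqxx /= ?orbT /= => /esym/eqP[->].
  by rewrite orbF => /esym/eqP[->].
pose b (u : F) := w (inl u).
pose e (u v : F) := ordered_pair u v.
pose p (u v : F) := [:: y u (e u v); w (inr (e u v)); y v (e u v)].
have neqF (u v : F) : adj u v -> u <> v by move=> + uv; rewrite uv adj_irrefl.
apply: (@has_induced_subdivisionI F G b p).
- by move=> u v /inj_w[].
- move=> u v uv; split.
  + by rewrite /p /e ordered_pairC.
  + rewrite /= !inE andbT; apply/andP; split; last by apply/eqP=> /esym/y_w.
    rewrite negb_or; apply/andP; split; apply/eqP; first exact: y_w.
    by case/inj_y => /(neqF _ _ uv).
  + move=> c; rewrite !inE !negb_or; apply/and3P; split; apply/eqP.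
    * by move/esym/y_w.
    * by move/inj_w.
    * by move/esym/y_w.
- move=> u v u' v' x uv uv' H1 H2; apply: ordered_pair_set; rewrite -/(e u v) -/(e u' v').
  move: H1 H2; rewrite !inE.
  case/or3P=> /eqP-> /or3P[] /eqP; try by [move/y_w | move/esym/y_w | case/inj_y].
  by move/inj_w => -[].
- have supp x : x \in subdivision_support b p ->
      (exists c, x = w c) \/ exists u v, adj u v /\ x = y u (e u v).
    case/supportP=> [[u ->]|[u [v [uv]]]]; first by left; exists (inl u).
    rewrite !inE => /or3P[] /eqP->; first by right; exists u, v.
      by left; exists (inr (e u v)).
    by right; exists v, u; rewrite adj_sym /e ordered_pairC.
  move=> x z xS zS; split.
    case/supp: xS => [[c ->]|[u [v [uv ->]]]];
      case/supp: zS => [[c' ->]|[u' [v' [uv' ->]]]].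
    + by rewrite (negbTE (ww _ _)).
    + rewrite wy => /orP[] /eqP->.
        by exists u', v'; rewrite /= !eqxx.
      exists v', u'; split; first by rewrite adj_sym.
      by rewrite /= /e (ordered_pairC v') !eqxx !orbT.
    + rewrite yw => /orP[] /eqP->.
        exists v, u; split; first by rewrite adj_sym.
        by rewrite /= /e (ordered_pairC v) !eqxx !orbT.
      by exists u, v; rewrite /= !eqxx !orbT.
    + by rewrite (negbTE (yy _ _ _ _)).
  case=> u [v [uv]]; rewrite /= !andbT !andbF !orbF.
  case/or4P=> /andP[/eqP-> /eqP->]; rewrite ?wy ?yw ?eqxx ?orbT //.
Qed.

(** * Light neighbourhoods: sampling a subdivided biclique *)

(** If a relation on O has density at least 1 / h, then at least the fraction
    h ^ - (#|A| * #|B|) of the maps from A + B to O sends A * B into the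
    relation: the power mean inequality is used once to choose the images of A
    under a common neighbour, and once more to choose the images of B. *)
Lemma dense_biclique_count (A B O : finType) (R : O -> O -> bool) (h : nat) :
  #|O| * #|O| <= h * #|[pred p : O * O | R p.1 p.2]| ->
  #|{ffun A + B -> O}| <= h ^ (#|A| * #|B|) *
    #|[pred t : {ffun A + B -> O} | [forall a, forall b, R (t (inl a)) (t (inr b))]]|.
Proof.
move=> dense.
pose col z := #|[pred o | R o z]|.
pose row (x : {ffun A -> O}) := #|[pred z | [forall a, R (x a) z]]|.
have sum_col : \sum_z col z = #|[pred p : O * O | R p.1 p.2]|.
  rewrite -sum_boolE -(pair_big xpredT xpredT (fun o z => R o z : nat)) exchange_big.
  by apply: eq_bigr => z _; rewrite /col -sum_boolE.
have sum_colX : \sum_z col z ^ #|A| = \sum_x row x.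
  under [RHS]eq_bigr do rewrite /row -sum_boolE.
  rewrite exchange_big; apply: eq_bigr => z _.
  rewrite /= sum_boolE /col -card_ffun_on; apply: eq_card => x.
  by apply/ffun_onP/forallP.
have := dense; rewrite -sum_col => /(power_mean #|A|); rewrite sum_colX => dense_row.
have dense' : #|{ffun A -> O}| * #|O| <= h ^ #|A| * \sum_x row x.
  by rewrite card_ffun mulnC.
have := power_mean #|B| dense'.
rewrite !card_ffun card_sum expnD -expnM => /leq_trans; apply.
rewrite leq_mul2l; apply/orP; right.
under eq_bigr => x _ do rewrite -card_ffun_on -sum_boolE.
rewrite pair_big /= sum_boolE.
pose glue (p : {ffun A -> O} * {ffun B -> O}) : {ffun A + B -> O} :=
  [ffun c => match c with inl a => p.1 a | inr b => p.2 b end].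
have glue_inj : injective glue.
  move=> [x z] [x' z'] /ffunP eqg; congr pair; apply/ffunP=> c.
    by have := eqg (inl c); rewrite !ffunE.
  by have := eqg (inr c); rewrite !ffunE.
rewrite -(card_image glue_inj); apply: subset_leq_card.
apply/subsetP=> _ /imageP[[x z] xz ->].
rewrite inE; apply/forallP=> a; apply/forallP=> b; rewrite !ffunE /=.
by move: xz; rewrite unfold_in /= => /ffun_onP/(_ b); rewrite inE => /forallP.
Qed.

(** Branch vertices are sampled independently from a distribution under which no
    neighbourhood is heavy; the subdividing vertex of an edge is a chosen common
    neighbour of its ends. A sampled vertex is then unlikely to be adjacent to
    another one, or to a subdividing vertex that it does not determine. *)
Section LightBiclique.
Variable G : sgraph.
Hypothesis tfG : triangle_free G.
Hypothesis common_nbr : forall x x' : G, ~~ adj x x' -> exists y, adj y x && adj y x'.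

Lemma nbrs_nonadj (v x y : G) : adj v x -> adj v y -> ~~ adj x y.
Proof. by move=> vx vy; apply/negP=> xy; case: tfG; exists v, x, y; rewrite vx xy vy. Qed.

Lemma common_nbr_fun : exists cn : G -> G -> G,
  forall x x', ~~ adj x x' -> adj (cn x x') x && adj (cn x x') x'.
Proof.
have H (p : G * G) : exists y, ~~ adj p.1 p.2 -> adj y p.1 && adj y p.2.
  have [|/common_nbr[y yP]] := boolP (adj p.1 p.2); first by exists p.1.
  by exists y.
have [cn cnP] := fin_all_exists H.
by exists (fun x x' => cn (x, x')) => x x'; apply: (cnP (x, x')).
Qed.

Variables (A B O : finType) (pt : O -> G) (q : nat).
Hypothesis light : forall v, #|[pred o | adj (pt o) v]| * q <= 2 * #|O|.

Let sample := {ffun A + B -> O}.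

(** The case c = d is there for injectivity: if cn x x is always a neighbour of
    x, then no x can be the image of two indices c and f. *)
Lemma private_sample (cn : G -> G -> G) (good : pred sample) :
    4 * #|{: A + B}| ^ 3 * #|{: sample}| < #|good| * q ->
  exists2 t, good t & forall c d f, f != c -> f != d ->
    ~~ adj (pt (t f)) (cn (pt (t c)) (pt (t d))) /\ ~~ adj (pt (t f)) (pt (t c)).
Proof.
move=> many.
pose vtx (e : ((A + B) * (A + B)) * ((A + B) * bool)) (t : sample) :=
  if e.2.2 then cn (pt (t e.1.1)) (pt (t e.1.2)) else pt (t e.1.1).
pose bad (e : ((A + B) * (A + B)) * ((A + B) * bool)) (t : sample) :=
  [&& e.2.1 != e.1.1, e.2.1 != e.1.2 & adj (pt (t e.2.1)) (vtx e t)].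
have bad_rare e : #|bad e| * q <= 2 * #|{: sample}|.
  apply: (@resample_bound _ _ (fun t b => fupd t e.2.1 b) (fun t => t e.2.1)) => [t b|t b|t].
  - exact: fupdK.
  - exact: fupdE.
  apply: leq_trans (light (vtx e t)); rewrite leq_mul2r; apply/orP; right.
  apply: subset_leq_card; apply/subsetP=> b; rewrite !inE => /and3P[fc fd].
  by rewrite fupdE /vtx !fupd_neq // eq_sym.
have [|t gt ok] := @union_bound _ _ good bad.
  have q0 : 0 < q by move: many; case: (q); rewrite // muln0.
  rewrite -(ltn_pmul2r q0) big_distrl /=.
  apply: leq_ltn_trans (leq_sum _ (fun e _ => bad_rare e)) _.
  rewrite sum_nat_const !card_prod card_bool; apply: leq_ltn_trans many.
  set s := #|_|; set N := #|_ : finType|; rewrite !expnS; lia.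
exists t => // c d f fc fd; split.
  by have := ok ((c, d), (f, true)); rewrite /bad /= fc fd.
by have := ok ((c, d), (f, false)); rewrite /bad /= fc fd.
Qed.

(** The subdividing vertices must also be pairwise nonadjacent. Two of them on
    edges that share an end are, as G is triangle-free. For disjoint edges there
    is a dichotomy, with h = 2 (#|A| * #|B|) ^ 2. If no vertex v is adjacent to
    the fraction 1 / h of the chosen common neighbours, adjacencies are so rare
    that at least half of the samples have none. If some v is, the relation
    adj v (cn x x') is dense, a fraction h ^ - (#|A| * #|B|) of the samples has
    all its subdividing vertices in the neighbourhood of v, and that is a stable
    set. Either way enough samples remain for [private_sample]. *)
Lemma light_biclique :
    0 < #|O| -> 0 < #|A| -> 0 < #|B| ->
    4 * (#|A| + #|B|) ^ 3 * (2 * (#|A| * #|B|) ^ 2) ^ (#|A| * #|B|) < q ->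
  induced_subdivided_biclique A B G.
Proof.
move=> O0 A0 B0; set h := 2 * _ ^ 2 => q_large.
have [cn cnP] := common_nbr_fun.
pose mid (t : sample) a b := cn (pt (t (inl a))) (pt (t (inr b))).
have [good good_large goodP] : exists2 good : pred sample,
    #|{: sample}| <= h ^ (#|A| * #|B|) * #|good| &
    forall t, good t -> forall a b a' b', a != a' -> b != b' ->
      ~~ adj (mid t a b) (mid t a' b').
  have [/forallP sparse|/forallPn[v]] := boolP [forall v : G,
      #|[pred p : O * O | adj v (cn (pt p.1) (pt p.2))]| * h <= #|O| * #|O|].
    pose conflict (e : (A * B) * (A * B)) (t : sample) :=
      [&& e.1.1 != e.2.1, e.1.2 != e.2.2 & adj (mid t e.1.1 e.1.2) (mid t e.2.1 e.2.2)].
    pose good (t : sample) := [forall e, ~~ conflict e t].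
    exists good; last first.
      move=> t /forallP gt a b a' b' aa bb; have := gt ((a, b), (a', b')).
      by rewrite /conflict /= aa bb.
    (* Resample the two ends of the second edge, the first one being fixed. *)
    have conflict_rare e : #|conflict e| * h <= 1 * #|{: sample}|.
      case: e => -[a b] [a' b'].
      apply: (@resample_bound _ _
        (fun t (o : O * O) => fupd (fupd t (inl a') o.1) (inr b') o.2)
        (fun t => (t (inl a'), t (inr b')))) => [t o|t o|t].
      - apply/ffunP=> c; rewrite !ffunE /=.
        by case: (c =P inr b') => [->|_] //; case: eqP => [->|].
      - by rewrite !ffunE !eqxx /=; case: o.
      rewrite mul1n card_prod; apply: leq_trans (sparse (mid t a b)).
      rewrite leq_mul2r; apply/orP; right.
      apply: subset_leq_card; apply/subsetP=> o; rewrite !inE /conflict /=.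
      move=> /and3P[aa bb].
      rewrite /mid !ffunE /= !eqxx (inj_eq (@inl_inj _ _)) (inj_eq (@inr_inj _ _)).
      by rewrite (negbTE aa) (negbTE bb).
    have bad_small : #|predC good| * h <= (#|A| * #|B|) ^ 2 * #|{: sample}|.
      have sub : #|predC good| <= \sum_e #|conflict e|.
        rewrite -sum_boolE; under [leqRHS]eq_bigr do rewrite -sum_boolE.
        rewrite exchange_big; apply: leq_sum => t _ /=.
        case: (boolP (good t)) => // /forallPn[e]; rewrite negbK => te.
        by rewrite (bigD1 e) //= te.
      apply: leq_trans (leq_mul sub (leqnn h)) _; rewrite big_distrl /=.
      apply: leq_trans (leq_sum _ (fun e _ => conflict_rare e)) _.
      by rewrite sum_nat_const !card_prod mul1n mulnn.
    have half : #|{: sample}| <= 2 * #|good|.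
      move: bad_small; rewrite -(cardC good) /h.
      have : 0 < (#|A| * #|B|) ^ 2 by rewrite expn_gt0 muln_gt0 A0 B0.
      set N := _ ^ 2; set x := #|predC good|; set y := #|good|; nia.
    apply: leq_trans half _; rewrite leq_mul2r; apply/orP; right.
    have AB0 : 0 < #|A| * #|B| by rewrite muln_gt0 A0.
    have h2 : 2 <= h by rewrite /h leq_pmulr // expn_gt0 AB0.
    by rewrite (leq_trans h2) // -[leqLHS]expn1 leq_pexp2l // ltnW.
  rewrite -ltnNge => dense.
  exists [pred t : sample | [forall a, forall b, adj v (mid t a b)]].
    apply: (@dense_biclique_count A B O (fun o o' => adj v (cn (pt o) (pt o'))) h).
    by apply/ltnW; rewrite mulnC.
  move=> t /forallP gt a b a' b' _ _.
  have /forallP/(_ b) h1 := gt a; have /forallP/(_ b') h2 := gt a'.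
  exact: nbrs_nonadj h1 h2.
have sample0 : 0 < #|{: sample}| by rewrite card_ffun expn_gt0 O0.
have good0 : 0 < #|good| by move: good_large sample0; case: #|good|; lia.
have [|t /goodP midP priv] := @private_sample cn good.
  rewrite card_sum; apply: leq_ltn_trans (leq_mul (leqnn _) good_large) _.
  by rewrite mulnA [leqRHS]mulnC ltn_pmul2r.
pose w c := pt (t c).
have ww c d : ~~ adj (w c) (w d).
  have [->|dc] := eqVneq c d; first by rewrite adj_irrefl.
  by have [] := priv d d c dc dc.
have cn_w c d f : adj (cn (w c) (w d)) (w f) = (f == c) || (f == d).
  have /andP[cnc cnd] := cnP _ _ (ww c d).
  have [->|fc] := eqVneq f c; first by rewrite cnc.
  have [->|fd] := eqVneq f d; first by rewrite cnd.
  by apply/negbTE; rewrite adj_sym; have [] := priv c d f fc fd.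
exists w, (fun a b => cn (w (inl a)) (w (inr b))); split=> //.
  move=> c d wcd; have := cn_w c c d; rewrite -wcd cn_w !eqxx !orbb.
  by move=> /esym/eqP->.
move=> a b a' b'.
have [<-|aa] := eqVneq a a'.
  by apply: (@nbrs_nonadj (w (inl a))); rewrite adj_sym cn_w eqxx.
have [<-|bb] := eqVneq b b'.
  by apply: (@nbrs_nonadj (w (inr b))); rewrite adj_sym cn_w eqxx orbT.
exact: midP.
Qed.
End LightBiclique.

(** * Shattered sets of vertices, colourings and common neighbours *)

(** One vertex x0 of X is set aside. Shattering provides vertices whose trace on
    X is x0 and two prescribed other vertices; having x0 as a common neighbour,
    they are pairwise nonadjacent. Likewise X is stable, since some vertex is
    adjacent to all of it. *)
Lemma shattered_biclique (A B : finType) (G : sgraph) (X : {set G}) :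
    triangle_free G -> #|A| + #|B| < #|X| ->
    (forall Z : {set G}, Z \subset X ->
      exists y, forall x, x \in X -> adj y x = (x \in Z)) ->
  induced_subdivided_biclique A B G.
Proof.
move=> tfG ltX shX.
have [x0 x0X] : exists x0, x0 \in X by apply/card_gt0P; lia.
have [w [inj_w wX]] : exists w : A + B -> G, injective w /\ forall c, w c \in X :\ x0.
  have sz : #|{: A + B}| <= #|X :\ x0| by rewrite card_sum; have := cardsD1 x0 X; lia.
  exists (fun c => enum_val (widen_ord sz (enum_rank c))); split=> [c d|c].
    by move/enum_val_inj => /(congr1 val) /= /val_inj /enum_rank_inj.
  exact: enum_valP.
have wXx c : w c \in X by have := wX c; rewrite inE => /andP[].
have wx0 c : w c != x0 by have := wX c; rewrite !inE => /andP[].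
have HZ (p : A * B) : exists y, forall x, x \in X ->
    adj y x = (x \in [set x0; w (inl p.1); w (inr p.2)]).
  by apply: shX; apply/subsetP=> x; rewrite !inE => /orP[/orP[]|] /eqP->.
have [y yP] := fin_all_exists HZ.
have [z zP] := shX X (subxx X).
exists w, (fun a b => y (a, b)); split=> //.
- by move=> c d; apply: (@nbrs_nonadj G tfG z); rewrite zP.
- by move=> a b c; rewrite yP // !inE (negbTE (wx0 c)) /= !(inj_eq inj_w).
- by move=> a b a' b'; apply: (@nbrs_nonadj G tfG x0); rewrite adj_sym yP // !inE eqxx.
Qed.

Lemma chromatic_number_min (G : sgraph) k : colorable G k -> chromatic_number G <= k.
Proof. by rewrite /chromatic_number; case: ex_minnP => m _; apply. Qed.

Lemma chromatic_number_total_dominating (G : sgraph) (S : {set G}) :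
    triangle_free G -> (forall x, exists2 v, v \in S & adj v x) ->
  chromatic_number G <= #|S|.
Proof.
move=> tfG domS; apply: chromatic_number_min.
have dom x : exists v : {v | v \in S}, adj (val v) x.
  by have [v vS vx] := domS x; exists (Sub v vS).
have [f fP] := fin_all_exists dom.
have cardS : #|{: {v | v \in S}}| = #|S| by rewrite card_sig.
apply/existsP; exists [ffun x => cast_ord cardS (enum_rank (f x))].
apply/forallP=> x; apply/forallP=> x'; apply/implyP; apply: contraTneq.
rewrite !ffunE => /cast_ord_inj/enum_rank_inj fxx'.
by apply: (@nbrs_nonadj G tfG (val (f x))); rewrite // fxx'.
Qed.

(** For x = x' the conclusion says that no vertex is isolated: an isolated vertex
    has no common neighbour with any other one, hence is the only vertex. *)
Lemma maximal_common_nbr (G : sgraph) :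
  maximal_triangle_free G -> 1 < chromatic_number G ->
  forall x x' : G, ~~ adj x x' -> exists y, adj y x && adj y x'.
Proof.
case=> tfG maxG chi1.
have distinct (x x' : G) : x != x' -> ~~ adj x x' -> exists y, adj y x && adj y x'.
  move=> xx' nadj; apply/existsP; case: (boolP [exists y, _]) => // /existsPn none.
  (* In a triangle of the extended graph that uses the edge ab = xx', the two
     edges at c are edges of G, so c is a common neighbour of x and x'. *)
  have new_edge a b c : [set a; b] == [set x; x'] ->
      add_edge_rel x x' b c -> add_edge_rel x x' a c -> False.
    move=> /eqP abx bc ac.
    have ca : c != a by apply: contraTneq ac => ->; rewrite add_edge_irrefl.
    have cb : c != b by apply: contraTneq bc => ->; rewrite add_edge_irrefl.
    have old d : d \in [set a; b] -> add_edge_rel x x' d c -> adj c d.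
      move=> dab; rewrite /add_edge_rel adj_sym => /orP[] // /andP[_ /eqP].
      rewrite -abx => /setP/(_ c); rewrite !inE eqxx orbT (negbTE ca) (negbTE cb).
      by [].
    have c_x d : d \in [set x; x'] -> adj c d.
      rewrite -abx => dab; move: (dab); rewrite !inE => /orP[] /eqP ed; subst d.
        exact: old dab ac.
      exact: old dab bc.
    by have := none c; rewrite !c_x // !inE eqxx ?orbT.
  case: (maxG x x' xx' nadj) => -[a [b [c /and3P[/= ab bc ac]]]].
  have sym u v : add_edge_rel x x' u v = add_edge_rel x x' v u by apply: add_edge_sym.
  have /orP[abG|/andP[_ abx]] := ab; last exact: new_edge abx bc ac.
  have /orP[bcG|/andP[_ bcx]] := bc; last first.
    by apply: (new_edge b c a) => //; rewrite sym.
  have /orP[acG|/andP[_ acx]] := ac; last first.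
    by apply: (new_edge a c b) => //; rewrite sym.
  by apply: tfG; exists a, b, c; rewrite abG bcG.
move=> x x' nadj; have [exx'|] := eqVneq x x'; last by move/distinct; apply.
rewrite -exx'; apply/existsP; case: (boolP [exists y, _]) => // /existsPn isolated.
have all_x u : u = x.
  apply/eqP/negPn/negP => ux; have nux : ~~ adj u x by have := isolated u; rewrite andbb.
  by have [y /andP[_ yx]] := distinct _ _ ux nux; have := isolated y; rewrite yx.
move: chi1; rewrite ltnNge => /negP[]; apply: chromatic_number_min.
apply/existsP; exists [ffun=> ord0]; apply/forallP=> u; apply/forallP=> v.
by rewrite (all_x u) (all_x v) adj_irrefl.
Qed.

(** * Choice of the parameters and conclusion *)

Lemma cube_lt_exp b : 16 <= b -> 2 * b ^ 3 + 1 < 2 ^ b.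
Proof.
elim: b => // b IHb; rewrite leq_eqVlt => /orP[/eqP <-|].
  by rewrite (expnM 2 4 4); lia.
move=> b16; have {}IHb := IHb b16; rewrite [2 ^ _]expnS.
apply: leq_trans (_ : 2 * (2 * b ^ 3 + 1).+1 <= _); last by rewrite leq_mul2l.
by rewrite !expnS !expn0 in IHb *; nia.
Qed.

(** The condition of [light_biclique] for sides of sizes l and l ^ 2. The main
    term is h ^ (l ^ 3) with h polynomial in l, that is 2 ^ O(l ^ 3 log l);
    bounding log l by l is what produces l ^ 4. *)
Lemma sampling_parameters l : 0 < l ->
  4 * (l + l * l) ^ 3 * (2 * (l * (l * l)) ^ 2) ^ (l * (l * l)) < 2 ^ (16 * l ^ 4).-1.
Proof.
case: l => // k _; set l := k.+1.
have lk : l <= 2 ^ k by rewrite ltn_expl.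
have l6 : l ^ 6 <= 2 ^ (6 * k) by rewrite mulnC expnM leq_expn2r.
have first : 4 * (l + l * l) ^ 3 <= 2 ^ (5 + 6 * k).
  rewrite expnD; apply: leq_trans (leq_mul (leqnn _) l6).
  apply: (@leq_trans (4 * (2 * l ^ 2) ^ 3)); last by rewrite expnMn -expnM; lia.
  by rewrite leq_mul2l leq_expn2r // -mulnn; nia.
have second : (2 * (l * (l * l)) ^ 2) ^ (l * (l * l)) <= 2 ^ ((1 + 6 * k) * l ^ 3).
  rewrite (_ : l * (l * l) = l ^ 3) // [leqRHS]expnM; apply: leq_expn2r.
  by rewrite -expnM expnD leq_mul.
apply: leq_ltn_trans (leq_mul first second) _; rewrite -expnD ltn_exp2l //.
have l_le : l <= l ^ 4 by rewrite -[leqLHS]expn1 leq_pexp2l.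
have -> : (1 + 6 * k) * l ^ 3 = 6 * l ^ 4 - 5 * l ^ 3.
  by rewrite [l ^ 4]expnS mulnA -mulnBl /l; congr (_ * _); lia.
have := expn_gt0 l 3; rewrite /= => l3.
have l34 : l ^ 3 <= l ^ 4 by rewrite leq_pexp2l.
rewrite -/l in l_le *; move: l_le l34 l3; rewrite {1}/l.
by move: (l ^ 4) (l ^ 3) => x y; lia.
Qed.

(** The conditions of [heavy_shatters] for m = 2 ^ b and shattered sets of size
    greater than s: the number of sampled points is below 2 ^ (2 * b), so D can
    be taken to be 2 * b * s. *)
Lemma net_parameters l (b := 16 * l ^ 4) (s := l + l * l) (D := 2 * b * s) : 0 < l ->
  2 * 2 ^ b * D ^ 2 < 2 ^ (2 * b) /\ (2 * 2 ^ b * D ^ 2).+1 ^ s < 2 ^ D.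
Proof.
move=> l0; have l4 : 0 < l ^ 4 by rewrite expn_gt0 l0.
have s2 : 4 * s ^ 2 <= b.
  have sl : s <= 2 * l ^ 2 by rewrite /s -mulnn; nia.
  by have := leq_expn2r 2 sl; rewrite expnMn -expnM /b; lia.
have b16 : 16 <= b by rewrite /b; lia.
have K_small : (2 * 2 ^ b * D ^ 2).+1 < 2 ^ (2 * b).
  rewrite [2 * b]mul2n -addnn expnD.
  have DE : 2 * 2 ^ b * D ^ 2 = 2 ^ b * (2 * b ^ 2 * (4 * s ^ 2)).
    by rewrite /D !expnMn; lia.
  apply: (@leq_ltn_trans (2 ^ b * (2 * b ^ 3 + 1))); last first.
    by rewrite ltn_pmul2l ?expn_gt0 // cube_lt_exp.
  rewrite DE mulnDr muln1 -[leqLHS]addn1; apply: leq_add; last by rewrite expn_gt0.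
  rewrite leq_mul2l; apply/orP; right.
  by rewrite [b ^ 3]expnSr [leqRHS]mulnA leq_mul2l s2 orbT.
split; first exact: ltnW.
have s0 : 0 < s by rewrite /s; lia.
by rewrite /D expnM ltn_exp2r.
Qed.

(** In the heavy case a total dominating set of size less than 2 ^ (2 * b) would
    colour G with too few colours, so the neighbourhoods shatter a large set; in
    the light case sampling applies. *)
Lemma induced_subdivision_of_chromatic (l : nat) (F G : sgraph) :
    0 < l -> #|F| = l -> maximal_triangle_free G ->
    2 ^ (32 * l ^ 4) <= chromatic_number G ->
  has_induced_subdivision F G.
Proof.
move=> l0 cardF maxG chi; have [tfG _] := maxG.
have chi1 : 1 < chromatic_number G.
  by apply: leq_trans chi; rewrite -[1](expn0 2) ltn_exp2l // muln_gt0 expn_gt0 l0.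
have nbr := maximal_common_nbr maxG chi1.
apply: biclique_subdivision.
pose b := 16 * l ^ 4; pose D := 2 * b * (l + l * l).
have b0 : 0 < b by rewrite muln_gt0 expn_gt0 l0.
have q2 : 2 * 2 ^ b.-1 = 2 ^ b by rewrite -expnS prednK.
have [small D_large] : 2 * 2 ^ b * D ^ 2 < 2 ^ (2 * b) /\
    (2 * 2 ^ b * D ^ 2).+1 ^ (l + l * l) < 2 ^ D by exact: net_parameters.
have [G0|G0] := posnP #|G|.
  move: chi1; rewrite ltnNge => /negP[]; apply: chromatic_number_min.
  apply/existsP; exists [ffun=> ord0]; apply/forallP=> u.
  by have := card0_eq G0 u.
have q0 : 0 < 2 ^ b.-1 by rewrite expn_gt0.
have [[O [pt [O0 heavy]]]|[O [pt [O0 light]]]] :=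
  @heavy_or_light G G (@adj G) _ q0 G0; last first.
  apply: (light_biclique tfG nbr light); rewrite ?card_prod ?cardF ?muln_gt0 ?l0 //.
  exact: sampling_parameters.
rewrite q2 in heavy.
have [|X sX shX] := heavy_shatters O0 heavy D_large; last first.
  by apply: (shattered_biclique tfG _ shX); rewrite card_prod cardF.
move=> S S_small.
have [/existsP[w /forall_inP wS]|/existsPn dom] :=
  boolP [exists w, [forall x in S, ~~ adj w x]]; first by exists w.
have chi_S : chromatic_number G <= #|S|.
  apply: chromatic_number_total_dominating => // x.
  have /forall_inPn[v vS] := dom x; rewrite negbK => xv.
  by exists v; rewrite // adj_sym.
have := leq_trans chi (leq_trans chi_S S_small).
by rewrite leqNgt (_ : 32 * l ^ 4 = 2 * b) ?small // /b mulnA.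
Qed.

Import Order.TTheory GRing.Theory Num.Theory.
Local Open Scope ring_scope.

Theorem theorem2 (R : realType) :
  exists c : R, 0 < c /\
    forall (l : nat) (F G : sgraph),
      (1 <= l)%N -> #|F| = l ->
      maximal_triangle_free G ->
      expR (c * l%:R ^+ 4) <= (chromatic_number G)%:R ->
      has_induced_subdivision F G.
Proof.
exists 32%:R; split=> // l F G l1 cardF maxG chi.
apply: (induced_subdivision_of_chromatic l1 cardF maxG).
rewrite -(ler_nat R); apply: le_trans chi.
(* The exponent is a natural number n, and expR n = expR 1 ^+ n >= 2 ^+ n. *)
rewrite -natrX -natrM -[X in expR X]mulr1 expRM_natl natrX.
by apply: lerXn2r; rewrite ?nnegrE ?expR_ge0 // expR_ge1Dx.
Qed.
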